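(* Let $S=k[x_1,\ldots,x_n]$ be the polynomial ring over a field $k$ and $I$ a constructible ideal generated in degree $q$. Assume that $I_1$ and $I_2$ are constructible ideals generated in degree $q$ such that $I_1\cap I_2$ is a constructible ideal generated in degree $q+1$ and $I=I_1+I_2$. Then, for all $i$, $$\beta_i(I)=\beta_i(I_1)+\beta_i(I_2)+\beta_{i-1}(I_1\cap I_2).$$
   Context: A monomial ideal of $S$ generated in a single degree $q$ is a constructible ideal if it can be obtained by the following recursive procedure: (i) if $u$ is a monomial of $S$ and $I=(u)$, then $I$ is constructible; (ii) if $I_1,I_2$ are constructible ideals generated in degree $q$ and $I_1\cap I_2$ is a constructible ideal generated in degree $q+1$, then $I_1+I_2$ is a constructible ideal. $\beta_i(M)=\dim_k\mathrm{Tor}_i^S(M,k)$ is the $i$-th (total) Betti number of $M$ over $S$, with $\beta_{-1}=0$. *)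

(* Defs.v *)
(* MathComp, with multinomials for k[x_1, ..., x_n] and the classical sets of
   mathcomp-classical for ideals. *)
From mathcomp Require Export all_boot all_order all_algebra.
From mathcomp Require Export mpoly.
From mathcomp Require Export boolp classical_sets.

Set Implicit Arguments.
Unset Strict Implicit.
Unset Printing Implicit Defensive.

Import GRing.Theory.
Local Open Scope classical_set_scope.
Local Open Scope ring_scope.

(* The ideal (u) generated by a monomial u, given by its exponent vector. *)
Definition principal_ideal (k : fieldType) (n : nat) (u : 'X_{1..n}) :
  set {mpoly k[n]} := [set p * 'X_[u] | p in [set: {mpoly k[n]}]].
Arguments principal_ideal k {n} u _.

Definition sum_ideal (k : fieldType) (n : nat) (I J : set {mpoly k[n]}) :
  set {mpoly k[n]} := [set p + r | p in I & r in J].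

(* [constructible q I]: I is a constructible ideal generated in degree q.  Any
   such set is an ideal generated by finitely many monomials of degree q, since
   both rules preserve this property; it need not be imposed separately. *)
Inductive constructible (k : fieldType) (n : nat) :
  nat -> set {mpoly k[n]} -> Prop :=
| constructible_principal (u : 'X_{1..n}) :
    constructible (mdeg u) (principal_ideal k u)
| constructible_sum (q : nat) (I1 I2 : set {mpoly k[n]}) :
    constructible q I1 -> constructible q I2 ->
    constructible q.+1 (I1 `&` I2) ->
    constructible q (sum_ideal I1 I2).

(* A sequence ... -> F_2 -> F_1 -> F_0 of free S-modules of finite rank; F_i is
   the module of row vectors of size [frk i], and the map F_(i+1) -> F_i is
   v |-> v *m fdiff i. *)
Record free_sequence (k : fieldType) (n : nat) := FreeSequence {
  frk : nat -> nat;
  fdiff : forall i, 'M[{mpoly k[n]}]_(frk i.+1, frk i)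
}.

(* ... -> F_1 -> F_0 -> I -> 0 is exact, the augmentation being v |-> v *m e. *)
Definition free_resolution (k : fieldType) (n : nat) (I : set {mpoly k[n]})
    (F : free_sequence k n) (e : 'cV[{mpoly k[n]}]_(frk F 0)) : Prop :=
  [/\ I = [set (v *m e) 0 0 | v in [set: 'rV_(frk F 0)]],
      forall v : 'rV_(frk F 0),
        v *m e = 0 <-> exists w : 'rV_(frk F 1), v = w *m fdiff F 0 &
      forall (i : nat) (v : 'rV_(frk F i.+1)),
        v *m fdiff F i = 0 <-> exists w : 'rV_(frk F i.+2), v = w *m fdiff F i.+1].

(* fdiff F i tensored with k = S / (x_1, ..., x_n): polynomials act on k through
   their constant terms. *)
Definition fdiff_k (k : fieldType) (n : nat) (F : free_sequence k n) (i : nat) :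
  'M[k]_(frk F i.+1, frk F i) := map_mx (mcoeff 0%MM) (fdiff F i).

(* A matrix whose row space is the space of i-cycles of the complex F (x)_S k. *)
Definition cycles_k (k : fieldType) (n : nat) (F : free_sequence k n) (i : nat) :
  'M[k]_(frk F i) :=
  if i is j.+1 then kermx (fdiff_k F j) else 1%:M.

(* dim_k H_i(F (x)_S k); the subtraction is not truncated on complexes. *)
Definition homology_dim (k : fieldType) (n : nat) (F : free_sequence k n)
  (i : nat) : nat := (\rank (cycles_k F i) - \rank (fdiff_k F i))%N.

(* dim_k Tor_i^S(I, k), computed from a free resolution of I by modules of
   finite rank: one exists for every ideal since S is Noetherian, and the
   dimension does not depend on it. *)
Definition tor_dim (k : fieldType) (n : nat) (I : set {mpoly k[n]}) (i : nat) :
  nat :=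
  xget 0%N [set b | exists (F : free_sequence k n)
                           (e : 'cV[{mpoly k[n]}]_(frk F 0)),
                      free_resolution I e /\ b = homology_dim F i].

(* Indexed by all integers, so that the Betti numbers of negative index are 0. *)
Definition betti (k : fieldType) (n : nat) (I : set {mpoly k[n]}) (i : int) :
  nat := if i is Posz j then tor_dim I j else 0%N.

(* Main.v *)
(* A constructible ideal generated in degree q has a linear resolution: entries
   of degree q in the augmentation and linear forms in the differentials.  Given
   linear resolutions of I1, I2 and I1 :&: I2, the inclusions of I1 :&: I2, which
   is generated one degree higher, lift to chain maps with linear entries, so the
   mapping cone of I1 :&: I2 -> I1 (+) I2 is a linear resolution of I1 + I2.
   Linear resolutions are minimal, hence their ranks are the Betti numbers.  This
   reading of Tor requires that it not depend on the resolution: two free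
   resolutions are homotopy equivalent, and this survives modulo the variables. *)

Require Import Defs.
From mathcomp Require Import zify.

Set Implicit Arguments.
Unset Strict Implicit.
Unset Printing Implicit Defensive.

Import GRing.Theory.
Local Open Scope classical_set_scope.
Local Open Scope ring_scope.

(** * Exactness for matrices acting on row vectors, and block matrices of cones *)

Definition exact_mx (R : pzRingType) m n p (A : 'M[R]_(m, n))
    (B : 'M[R]_(n, p)) : Prop :=
  forall v : 'rV_n, v *m B = 0 <-> exists w, v = w *m A.

Section Exactness.
Variable R : pzRingType.

Lemma mulmx_row_factor m n p (A : 'M[R]_(m, n)) (C : 'M[R]_(p, n)) :
  (forall i, exists w, row i C = w *m A) -> exists W, C = W *m A.
Proof.
move=> /fin_all_exists[w wE]; exists (\matrix_i w i).
by apply/row_matrixP => i; rewrite row_mul rowK.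
Qed.

Lemma exact_mx0 m n p (A : 'M[R]_(m, n)) (B : 'M[R]_(n, p)) :
  exact_mx A B -> A *m B = 0.
Proof.
move=> AB; apply/row_matrixP => i; rewrite row_mul row0; apply/AB.
by exists (delta_mx 0 i); rewrite rowE.
Qed.

(** Projectivity of free modules: each row of [C] is a cycle, and the rows are lifted one at a
    time. *)
Lemma exact_mx_factor m n p r (A : 'M[R]_(m, n)) (B : 'M[R]_(n, p))
    (C : 'M[R]_(r, n)) :
  exact_mx A B -> C *m B = 0 -> exists W, C = W *m A.
Proof.
by move=> AB CB0; apply: mulmx_row_factor => i; apply/AB; rewrite -row_mul CB0 row0.
Qed.

Lemma exact_block_diag m1 n1 p1 m2 n2 p2
    (A1 : 'M[R]_(m1, n1)) (B1 : 'M[R]_(n1, p1))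
    (A2 : 'M[R]_(m2, n2)) (B2 : 'M[R]_(n2, p2)) :
  exact_mx A1 B1 -> exact_mx A2 B2 ->
  exact_mx (block_mx A1 0 0 A2) (block_mx B1 0 0 B2).
Proof.
move=> AB1 AB2 v; rewrite -[v]hsubmxK; move: (lsubmx v) (rsubmx v) => v1 v2.
rewrite mul_row_block !mulmx0 addr0 add0r; split=> [|[w]].
  rewrite -row_mx0 => /eq_row_mx[/AB1[w1 ->] /AB2[w2 ->]].
  by exists (row_mx w1 w2); rewrite mul_row_block !mulmx0 addr0 add0r.
rewrite -[w]hsubmxK mul_row_block !mulmx0 addr0 add0r => /eq_row_mx[-> ->].
by rewrite -!mulmxA (exact_mx0 AB1) (exact_mx0 AB2) !mulmx0 row_mx0.
Qed.

(* The last hypothesis is weaker than exactness of [E2], [E1]: at the start of a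
   resolution [E1] is not the augmentation but a matrix without columns. *)
Lemma exact_cone x2 x1 x0 g2 g1 g0
    (D2 : 'M[R]_(x2, x1)) (D1 : 'M[R]_(x1, x0))
    (E2 : 'M[R]_(g2, g1)) (E1 : 'M[R]_(g1, g0))
    (f2 : 'M[R]_(g2, x1)) (f1 : 'M[R]_(g1, x0)) :
  exact_mx D2 D1 -> E2 *m E1 = 0 -> E2 *m f1 = f2 *m D1 ->
  (forall g : 'rV_g1, g *m E1 = 0 -> (exists x, g *m f1 = x *m D1) ->
    exists g', g = g' *m E2) ->
  exact_mx (block_mx D2 0 f2 (- E2)) (block_mx D1 0 f1 (- E1)).
Proof.
move=> D21 E21 fE cycle v; rewrite -[v]hsubmxK.
move: (lsubmx v) (rsubmx v) => x g.
rewrite mul_row_block mulmx0 add0r mulmxN; split=> [|[w]].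
  rewrite -row_mx0 => /eq_row_mx[xg0 /eqP]; rewrite oppr_eq0 => /eqP gE0.
  have [|g' gE] := cycle g gE0.
    by exists (- x); rewrite mulNmx; apply/eqP; rewrite -addr_eq0 addrC xg0.
  have /D21[x' xE] : (x + g' *m f2) *m D1 = 0.
    by rewrite mulmxDl -mulmxA -fE mulmxA -gE.
  exists (row_mx x' (- g')); rewrite mul_row_block mulmx0 add0r -xE.
  by rewrite mulNmx addrK mulNmx mulmxN opprK gE.
rewrite -[w]hsubmxK mul_row_block mulmx0 add0r => /eq_row_mx[-> ->].
rewrite mulmxN !mulNmx mulmxDl -!mulmxA (exact_mx0 D21) E21 fE.
by rewrite !mulmx0 add0r subrr !oppr0 row_mx0.
Qed.

(** Bottom of the cone: the shifted complex is zero there, so [o] has no columns and the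
    augmentation has an empty lower block. *)
Lemma exact_cone0 x1 x0 g0 p (D : 'M[R]_(x1, x0)) (f : 'M[R]_(g0, x0))
    (e : 'M[R]_(x0, p)) (o : 'M[R]_(g0, 0)) :
  D *m e = 0 -> f *m e = 0 ->
  (forall x : 'rV_x0, x *m e = 0 -> exists y g, x = y *m D + g *m f) ->
  exact_mx (block_mx D 0 f o) (col_mx e (0 : 'M_(0, p))).
Proof.
move=> De0 fe0 gen v; rewrite -[v]hsubmxK.
move: (lsubmx v) (rsubmx v) => x z; rewrite [z]thinmx0.
rewrite mul_row_col mulmx0 addr0; split=> [/gen[y [g xE]]|[w]].
  by exists (row_mx y g); rewrite mul_row_block -xE; congr row_mx; rewrite !thinmx0.
rewrite -[w]hsubmxK mul_row_block => /eq_row_mx[-> _].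
by rewrite mulmxDl -!mulmxA De0 fe0 !mulmx0 addr0.
Qed.

End Exactness.

(** * Independence of Tor from the resolution *)

(** The map induced by [f] on homology is injective, with left inverse induced by [g]: a cycle that
    [f] sends to a boundary is a boundary. *)
Lemma leq_rank_homology (K : fieldType) m1 m2 n1 n2 p1 p2
    (Z1 : 'M[K]_(p1, n1)) (B1 : 'M[K]_(m1, n1))
    (Z2 : 'M[K]_(p2, n2)) (B2 : 'M[K]_(m2, n2))
    (f : 'M[K]_(n1, n2)) (g : 'M[K]_(n2, n1)) :
  (Z1 *m f <= Z2)%MS -> (B2 <= Z2)%MS -> (B2 *m g <= B1)%MS ->
  (Z1 *m (f *m g - 1%:M) <= B1)%MS ->
  (\rank Z1 - \rank B1 <= \rank Z2 - \rank B2)%N.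
Proof.
move=> Zf BZ Bg Zfg.
pose h := f *m cokermx B2.
have kerB : (Z1 :&: kermx h <= B1)%MS.
  set z := (_ :&: _)%MS.
  have zZ : (z <= Z1)%MS := capmxSl _ _.
  have zf : (z *m f <= B2)%MS.
    by rewrite submxE -mulmxA; apply/eqP/sub_kermxP; exact: capmxSr.
  have -> : z = z *m f *m g - z *m (f *m g - 1%:M).
    by rewrite mulmxBr mulmx1 mulmxA opprB addrC subrK.
  rewrite addmx_sub // ?eqmx_opp.
    exact: submx_trans (submxMr _ zf) Bg.
  exact: submx_trans (submxMr _ zZ) Zfg.
have r1 := mxrank_mul_ker Z1 h; have r2 := mxrank_mul_ker Z2 (cokermx B2).
have l1 := mxrankS kerB.
have l2 : (\rank B2 <= \rank (Z2 :&: kermx (cokermx B2)))%N.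
  by apply: mxrankS; rewrite sub_capmx BZ; apply/sub_kermxP/mulmx_coker.
have l3 : (\rank (Z1 *m h) <= \rank (Z2 *m cokermx B2))%N.
  by rewrite mulmxA; apply/mxrankS/submxMr.
lia.
Qed.

Section Resolutions.
Variables (k : fieldType) (n : nat).
Local Notation S := {mpoly k[n]}.
Implicit Types F G : free_sequence k n.

(* The augmentation becomes the differential of index 0, so that F_i has index
   [i.+1]. *)
Definition augment F (e : 'cV[S]_(frk F 0)) : free_sequence k n :=
  @FreeSequence k n (fun i => if i is j.+1 then frk F j else 1%N)
    (fun i => match i with 0 => e | j.+1 => fdiff F j end).

(** Nothing is required at index 0: an augmented resolution of [I] has cokernel S/I there. *)
Definition acyclic F : Prop := forall i, exact_mx (fdiff F i.+1) (fdiff F i).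

Lemma free_resolution_acyclic (I : set S) F (e : 'cV_(frk F 0)) :
  free_resolution I e -> acyclic (augment e).
Proof. by case=> _ e0 d0 [|i]; [exact: e0 | exact: d0]. Qed.

Lemma chain_lift F G (f0 : 'M_(frk F 0, frk G 0)) (f1 : 'M_(frk F 1, frk G 1)) :
  (forall i, fdiff F i.+1 *m fdiff F i = 0) -> acyclic G ->
  fdiff F 0 *m f0 = f1 *m fdiff G 0 ->
  exists f : forall i, 'M_(frk F i, frk G i),
    f 0 = f0 /\ forall i, fdiff F i *m f i = f i.+1 *m fdiff G i.
Proof.
move=> FF acG f01.
(* Two consecutive components and their commuting square are the data from which the next component
   is chosen. *)
pose P i := {f : 'M_(frk F i, frk G i) & {f' : 'M_(frk F i.+1, frk G i.+1) |
  fdiff F i *m f = f' *m fdiff G i}}.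
have step i (t : P i) : {t' : P i.+1 | projT1 t' = sval (projT2 t)}.
  case: t => f [f' ff'] /=.
  have /(exact_mx_factor (acG i))/cid[f'' fE] :
    (fdiff F i.+1 *m f') *m fdiff G i = 0.
    by rewrite -mulmxA -ff' mulmxA FF mul0mx.
  by exists (existT _ f' (exist _ f'' fE)).
pose t := fix t i : P i :=
  match i with 0 => existT _ f0 (exist _ f1 f01) | j.+1 => sval (step j (t j)) end.
exists (fun i => projT1 (t i)); split=> // i.
by rewrite /= (svalP (step i (t i))); case: (projT2 (t i)).
Qed.

Lemma chain_null_homotopy F G (f : forall i, 'M_(frk F i, frk G i)) :
  (forall i, fdiff F i.+1 *m fdiff F i = 0) -> acyclic G ->
  (forall i, fdiff F i *m f i = f i.+1 *m fdiff G i) -> f 0 = 0 ->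
  exists h : forall i, 'M_(frk F i, frk G i.+1),
    h 0 = 0 /\ forall i, f i.+1 = h i.+1 *m fdiff G i.+1 + fdiff F i *m h i.
Proof.
move=> FF acG fE f0.
(* This equation says that [f i.+1 - fdiff F i *m h] is killed by [fdiff G i], hence lifts; at index
   0 both sides vanish for [h = 0]. *)
pose P i := {h : 'M_(frk F i, frk G i.+1) |
  fdiff F i *m f i = fdiff F i *m h *m fdiff G i}.
have step i (t : P i) : {t' : P i.+1 |
    f i.+1 = sval t' *m fdiff G i.+1 + fdiff F i *m sval t}.
  case: t => h hE /=.
  have /(exact_mx_factor (acG i))/cid[h' h'E] :
    (f i.+1 - fdiff F i *m h) *m fdiff G i = 0.
    by rewrite mulmxBl -fE hE subrr.
  have fS : f i.+1 = h' *m fdiff G i.+1 + fdiff F i *m h by rewrite -h'E subrK.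
  have h'P : fdiff F i.+1 *m f i.+1 = fdiff F i.+1 *m h' *m fdiff G i.+1.
    by rewrite fS mulmxDr !mulmxA FF mul0mx addr0.
  by exists (exist _ h' h'P).
have h0P : fdiff F 0 *m f 0 = fdiff F 0 *m 0 *m fdiff G 0.
  by rewrite f0 !mulmx0 mul0mx.
pose t := fix t i : P i :=
  match i with 0 => exist _ 0 h0P | j.+1 => sval (step j (t j)) end.
exists (fun i => sval (t i)); split=> // i.
exact: (svalP (step i (t i))).
Qed.

(** The identity of S in index 0 encodes the inclusion of [J] in [I]; it lifts because the entries
    of [eG] lie in [I]. *)
Lemma resolution_map (I J : set S) F G (eF : 'cV_(frk F 0)) (eG : 'cV_(frk G 0)) :
  free_resolution I eF -> free_resolution J eG -> J `<=` I ->
  exists f : forall i, 'M_(frk (augment eG) i, frk (augment eF) i),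
    f 0 = 1%:M /\
    forall i, fdiff (augment eG) i *m f i = f i.+1 *m fdiff (augment eF) i.
Proof.
move=> resF resG JI.
have [f1 f1E] : exists f1, eG = f1 *m eF.
  apply: mulmx_row_factor => i.
  have : I (eG i 0).
    apply: JI; case: resG => -> _ _; exists (delta_mx 0 i) => //.
    by rewrite -rowE mxE.
  case: resF => -> _ _ [w _ wE]; exists w; apply/matrixP => a b.
  by rewrite !ord1 mxE wE.
apply: (@chain_lift (augment eG) (augment eF) 1%:M f1); last by rewrite mulmx1.
  by move=> i; exact/exact_mx0/(free_resolution_acyclic resG).
exact: free_resolution_acyclic resF.
Qed.

(** Chain maps both ways extend the identity of S, so their composite minus the identity is
    null-homotopic, also modulo the variables. *)
Lemma leq_homology_dim (I : set S) F G (eF : 'cV_(frk F 0)) (eG : 'cV_(frk G 0)) i :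
  free_resolution I eF -> free_resolution I eG ->
  (homology_dim F i <= homology_dim G i)%N.
Proof.
move=> resF resG.
have [f [f0 fE]] := resolution_map resG resF (@subset_refl _ _).
have [g [g0 gE]] := resolution_map resF resG (@subset_refl _ _).
have acF := free_resolution_acyclic resF.
have acG := free_resolution_acyclic resG.
have FF j := exact_mx0 (acF j); have GG j := exact_mx0 (acG j).
have [||h [h0 hE]] :=
    chain_null_homotopy (f := fun j => f j *m g j - 1%:M) FF acF.
- move=> j; rewrite mulmxBr mulmxBl mulmx1 mul1mx mulmxA fE -!mulmxA.
  by rewrite gE.
- by rewrite f0 g0 mulmx1 subrr.
pose ev a b (A : 'M[S]_(a, b)) := map_mx (mcoeff 0%MM) A.
have gEk : fdiff_k G i *m ev _ _ (g i.+1) = ev _ _ (g i.+2) *m fdiff_k F i.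
  by rewrite -!map_mxM (gE i.+1).
have hEk : ev _ _ (f i.+1) *m ev _ _ (g i.+1) - 1%:M =
    ev _ _ (h i.+1) *m fdiff_k F i + ev _ _ (fdiff (augment eF) i *m h i).
  by rewrite -map_mxM -(map_mx1 (@mcoeff n k 0%MM)) -map_mxB hE map_mxD map_mxM.
apply: (leq_rank_homology (f := ev _ _ (f i.+1)) (g := ev _ _ (g i.+1))).
- case: i {gEk hEk} => [|i]; first exact: submx1.
  apply/sub_kermxP; rewrite -mulmxA.
  have <- : fdiff_k F i *m ev _ _ (f i.+1) = ev _ _ (f i.+2) *m fdiff_k G i.
    by rewrite -!map_mxM (fE i.+1).
  by rewrite mulmxA mulmx_ker mul0mx.
- case: i {gEk hEk} => [|i]; first exact: submx1.
  by apply/sub_kermxP; rewrite -map_mxM (GG i.+1) map_mx0.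
- by rewrite gEk submxMl.
rewrite hEk mulmxDr mulmxA addmx_sub ?submxMl //.
(* The remaining homotopy term passes through the augmentation in index 0, where [h 0 = 0]; in
   higher index it vanishes on cycles. *)
case: i {gEk hEk} => [|i]; first by rewrite h0 mulmx0 /ev map_mx0 mulmx0 sub0mx.
by rewrite /ev map_mxM mulmxA [X in X *m _]mulmx_ker mul0mx sub0mx.
Qed.

Lemma tor_dimE (I : set S) F (e : 'cV_(frk F 0)) i :
  free_resolution I e -> tor_dim I i = homology_dim F i.
Proof.
move=> resF; apply: xget_unique; first by exists F, e.
move=> _ [G [eG [resG ->]]].
apply/eqP; rewrite eqn_leq (leq_homology_dim i resG resF).
exact: leq_homology_dim resF resG.
Qed.

Lemma homology_dim_minimal F i : (forall j, fdiff_k F j = 0) ->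
  homology_dim F i = frk F i.
Proof.
move=> F0; rewrite /homology_dim F0 mxrank0 subn0.
by case: i => [|i] /=; rewrite ?F0 ?kermx0 mxrank1.
Qed.

(** * Homogeneous matrices and homogeneous components *)

Definition homog_mx d p r (A : 'M[S]_(p, r)) : Prop :=
  forall i j, A i j \is d.-homog.

Lemma homog_mx0 d p r : homog_mx d (0 : 'M_(p, r)).
Proof. by move=> i j; rewrite mxE dhomog0. Qed.

Lemma homog_mxN d p r (A : 'M_(p, r)) : homog_mx d A -> homog_mx d (- A).
Proof. by move=> hA i j; rewrite mxE dhomogN. Qed.

Lemma homog_row_mx d p r1 r2 (A : 'M_(p, r1)) (B : 'M_(p, r2)) :
  homog_mx d A -> homog_mx d B -> homog_mx d (row_mx A B).
Proof. by move=> hA hB i j; rewrite mxE; case: splitP. Qed.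

Lemma homog_col_mx d p1 p2 r (A : 'M_(p1, r)) (B : 'M_(p2, r)) :
  homog_mx d A -> homog_mx d B -> homog_mx d (col_mx A B).
Proof. by move=> hA hB i j; rewrite mxE; case: splitP. Qed.

Lemma homog_block_mx d p1 p2 r1 r2 (A : 'M_(p1, r1)) (B : 'M_(p1, r2))
    (C : 'M_(p2, r1)) (D : 'M_(p2, r2)) :
  homog_mx d A -> homog_mx d B -> homog_mx d C -> homog_mx d D ->
  homog_mx d (block_mx A B C D).
Proof. by move=> *; apply: homog_col_mx; apply: homog_row_mx. Qed.

Lemma homog_mx_mcoeff0 d p r (A : 'M_(p, r)) :
  homog_mx d.+1 A -> map_mx (mcoeff 0%MM) A = 0.
Proof.
move=> hA; apply/matrixP => i j; rewrite !mxE.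
by apply: dhomog_nemf_coeff (hA i j) _; rewrite /= mdeg0.
Qed.

Lemma pihomogMr d q (p h : S) : h \is q.-homog ->
  pihomog mdeg (d + q) (p * h) = pihomog mdeg d p * h.
Proof.
move=> hh; pose K := maxn d.+1 (mmeasure mdeg p).
(* [K] bounds the degree of [p] and exceeds [d], so the component of degree [d] is a term of the
   decomposition of [p]. *)
have dK : (d < K)%N by rewrite leq_maxl.
rewrite {1}(pihomog_partitionE (leq_maxr d.+1 (mmeasure mdeg p))) -/K.
rewrite mulr_suml raddf_sum (bigD1 (Ordinal dK)) //= big1 => [|j jd].
  by rewrite addr0 pihomog_dE // dhomogM // pihomogP.
rewrite (pihomog_ne0 (d := j + q)%N) ?dhomogM ?pihomogP //.
by rewrite eqn_add2r.
Qed.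

Lemma pihomogMl d q (p h : S) : h \is q.-homog ->
  pihomog mdeg (q + d) (h * p) = h * pihomog mdeg d p.
Proof. by move=> hh; rewrite addnC mulrC pihomogMr // mulrC. Qed.

Lemma pihomog_mxM d q p r s (A : 'M[S]_(p, r)) (B : 'M_(r, s)) :
  homog_mx q B ->
  map_mx (pihomog mdeg (d + q)) (A *m B) = map_mx (pihomog mdeg d) A *m B.
Proof.
move=> hB; apply/matrixP => i j; rewrite !mxE raddf_sum.
by apply: eq_bigr => l _ /=; rewrite pihomogMr // mxE.
Qed.

Lemma pihomog_Mmx d q p r s (A : 'M[S]_(p, r)) (B : 'M_(r, s)) :
  homog_mx q A ->
  map_mx (pihomog mdeg (q + d)) (A *m B) = A *m map_mx (pihomog mdeg d) B.
Proof.
move=> hA; apply/matrixP => i j; rewrite !mxE raddf_sum.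
by apply: eq_bigr => l _ /=; rewrite pihomogMl // mxE.
Qed.

Lemma pihomog_mx_id d p r (A : 'M[S]_(p, r)) :
  homog_mx d A -> map_mx (pihomog mdeg d) A = A.
Proof. by move=> hA; apply/matrixP => i j; rewrite mxE pihomog_dE. Qed.

(** * Linear resolutions and their mapping cones *)

Definition linear_resolution q (I : set S) F (e : 'cV_(frk F 0)) : Prop :=
  [/\ free_resolution I e, homog_mx q e & forall i, homog_mx 1 (fdiff F i)].

Lemma tor_dim_linear q (I : set S) F (e : 'cV_(frk F 0)) i :
  linear_resolution q I e -> tor_dim I i = frk F i.
Proof.
move=> [resF _ linF]; rewrite (tor_dimE _ resF) homology_dim_minimal // => j.
exact: homog_mx_mcoeff0 (linF j).
Qed.

(* Only the degree one part of an arbitrary lift is kept: it commutes with the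
   differentials because these are homogeneous. *)
Lemma linear_lift q (I J : set S) F G (eF : 'cV_(frk F 0)) (eG : 'cV_(frk G 0)) :
  linear_resolution q I eF -> linear_resolution q.+1 J eG -> J `<=` I ->
  exists f : forall i, 'M_(frk G i, frk F i),
    [/\ forall i, homog_mx 1 (f i), eG = f 0 *m eF &
        forall i, fdiff G i *m f i = f i.+1 *m fdiff F i].
Proof.
move=> [resF heF linF] [resG heG linG] JI.
have [f [f0 fE]] := resolution_map resF resG JI.
exists (fun i => map_mx (pihomog mdeg 1) (f i.+1)); split.
- by move=> i a b; rewrite mxE pihomogP.
(* [eG] has degree [1 + q] and [eF] degree [q], so the degree one part of the lift suffices. *)
- rewrite -(pihomog_mxM _ _ heF) -(fE 0) f0 mulmx1.
  by rewrite pihomog_mx_id.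
- move=> i; rewrite -(pihomog_mxM _ _ (linF i)) -(pihomog_Mmx _ _ (linG i)).
  by rewrite (fE i.+1).
Qed.

Definition direct_sum F G : free_sequence k n :=
  @FreeSequence k n (fun i => (frk F i + frk G i)%N)
    (fun i => block_mx (fdiff F i) 0 0 (fdiff G i)).

Definition shift_rank G i : nat := if i is j.+1 then frk G j else 0%N.

Definition shift_diff G i : 'M[S]_(frk G i, shift_rank G i) :=
  match i with 0 => 0 | j.+1 => fdiff G j end.

(** The sign makes consecutive differentials compose to zero when [f] is a chain map. *)
Definition mapping_cone G F (f : forall i, 'M_(frk G i, frk F i)) :
    free_sequence k n :=
  @FreeSequence k n (fun i => (frk F i + shift_rank G i)%N)
    (fun i => block_mx (fdiff F i) 0 (f i) (- shift_diff G i)).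

(** The cone lifts the exact sequence 0 -> I1 :&: I2 -> I1 (+) I2 -> I1 + I2 -> 0. *)
Lemma linear_resolution_sum q (I1 I2 : set S) F1 F2 G
    (e1 : 'cV_(frk F1 0)) (e2 : 'cV_(frk F2 0)) (eG : 'cV_(frk G 0)) :
  linear_resolution q I1 e1 -> linear_resolution q I2 e2 ->
  linear_resolution q.+1 (I1 `&` I2) eG ->
  exists F (e : 'cV_(frk F 0)), linear_resolution q (sum_ideal I1 I2) e /\
    forall i, frk F i = (frk F1 i + frk F2 i + shift_rank G i)%N.
Proof.
move=> lin1 lin2 linG.
have [f1 [hf1 eG1 f1E]] := linear_lift lin1 linG (@subIsetl _ _ _).
have [f2 [hf2 eG2 f2E]] := linear_lift lin2 linG (@subIsetr _ _ _).
have {lin1} [res1 he1 hd1] := lin1; have {lin2} [res2 he2 hd2] := lin2.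
have {linG} [resG heG hdG] := linG.
have [I1E _ _] := res1; have [I2E _ _] := res2; have [IGE _ _] := resG.
have ac1 := free_resolution_acyclic res1.
have ac2 := free_resolution_acyclic res2.
have acG := free_resolution_acyclic resG.
(* The minus sign makes the augmentation [(e1, e2)] vanish on the image of [f 0]. *)
pose f i : 'M_(frk G i, frk (direct_sum F1 F2) i) := row_mx (f1 i) (- f2 i).
have fE i : fdiff G i *m f i = f i.+1 *m fdiff (direct_sum F1 F2) i.
  rewrite mul_mx_row mul_row_block !mulmx0 addr0 add0r.
  by rewrite mulmxN mulNmx f1E f2E.
pose e : 'cV_(frk (mapping_cone f) 0) := col_mx (col_mx e1 e2) (0 : 'M_(0, 1)).
exists (mapping_cone f), e; split=> //; split.
- split.
  + apply/seteqP; split=> [_ [p I1p [r I2r <-]]|_ [v _ <-]].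
        move: I1p I2r; rewrite {1}I1E {1}I2E => -[u _ <-] [w _ <-].
      exists (row_mx (row_mx u w) 0) => //.
      by rewrite !mul_row_col mulmx0 addr0 mxE.
    rewrite -[v]hsubmxK; move: (lsubmx v) (rsubmx v) => w z.
    rewrite -[w]hsubmxK !mul_row_col mulmx0 addr0 mxE.
    exists ((lsubmx w *m e1) 0 0); first by rewrite I1E; exists (lsubmx w).
    by exists ((rsubmx w *m e2) 0 0) => //; rewrite I2E; exists (rsubmx w).
  + apply: exact_cone0.
    * rewrite mul_block_col !mul0mx addr0 add0r (exact_mx0 (ac1 0)).
      by rewrite (exact_mx0 (ac2 0)) col_mx0.
    * by rewrite mul_row_col mulNmx -eG1 -eG2 subrr.
    move=> x; rewrite -[x]hsubmxK; move: (lsubmx x) (rsubmx x) => a b.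
    rewrite mul_row_col => /eqP; rewrite addr_eq0 => /eqP abE.
    (* The common value of [a *m e1] and [- b *m e2] lies in the intersection; subtracting its lift
       leaves a cycle in each summand. *)
    have [g gE] : exists g, a *m e1 = g *m eG.
      have : (I1 `&` I2) ((a *m e1) 0 0).
        split; first by rewrite I1E; exists a.
        by rewrite abE I2E; exists (- b) => //; rewrite mulNmx.
      rewrite IGE => -[g _ gE]; exists g; apply/matrixP => i j.
      by rewrite !ord1 gE.
    have /(ac1 0)[a' a'E] : (a - g *m f1 0) *m e1 = 0.
      by rewrite mulmxBl gE eG1 mulmxA subrr.
    have /(ac2 0)[b' b'E] : (b + g *m f2 0) *m e2 = 0.
      by rewrite mulmxDl -mulmxA -eG2 -gE abE subrr.
    exists (row_mx a' b'), g.
    rewrite mul_row_block !mulmx0 addr0 add0r mul_mx_row add_row_mx.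
    by rewrite mulmxN -[a' *m _]a'E -[b' *m _]b'E subrK addrK.
  + move=> i; apply: exact_cone.
    * exact: exact_block_diag (ac1 i.+1) (ac2 i.+1).
    * by case: i => [|i] /=; rewrite ?mulmx0 ?(exact_mx0 (acG i.+1)).
    * exact: fE.
    case: i => [|i] g /= gE0 [x xE]; last exact/(acG i.+1).
    (* In index 0, [gE0] is vacuous. Augmenting the first component of [xE] by [e1] gives
       [g *m eG = 0] instead. *)
    apply/(acG 0); have := congr1 (mulmx^~ (col_mx e1 0)) xE.
    rewrite /= -!mulmxA mul_row_col mulmx0 addr0 -eG1 => ->.
    rewrite mul_block_col !mulmx0 !mul0mx !addr0 (exact_mx0 (ac1 0)).
    by rewrite col_mx0 mulmx0.
- by apply: homog_col_mx; [apply: homog_col_mx | apply: homog_mx0].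
- move=> i; apply: homog_block_mx.
  + by apply: homog_block_mx => //; apply: homog_mx0.
  + exact: homog_mx0.
  + by apply: homog_row_mx; [exact: hf1 | exact/homog_mxN/hf2].
  + by apply: homog_mxN; case: i => [|i] //=; apply: homog_mx0.
Qed.

(** S is a domain, so (u) is free of rank one and its resolution stops at index 0. *)
Lemma linear_resolution_principal (u : 'X_{1..n}) :
  exists F (e : 'cV_(frk F 0)),
    linear_resolution (mdeg u) (principal_ideal k u) e.
Proof.
exists (@FreeSequence k n (fun i => (i == 0)%N) (fun=> 0)), ('X_[u])%:M.
split; last by move=> i; exact: homog_mx0.
- split=> [|v|i v].
  + apply/seteqP; split=> [_ [p _ <-]|_ [v _ <-]].
      by exists p%:M => //; rewrite -scalar_mxM mxE eqxx mulr1n.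
    by exists (v 0 0) => //; rewrite mul_mx_scalar mxE mulrC.
  + rewrite mul_mx_scalar; split=> [vu|[w ->]]; last by rewrite mulmx0 scaler0.
    exists 0; rewrite mulmx0; apply/matrixP => i j; apply/eqP.
    have /eqP := congr1 (fun M : 'M_(_, _) => M i j) vu.
    by rewrite !mxE mulf_eq0 -msupp_eq0 msuppX.
  + split=> _; last by rewrite mulmx0.
    by exists 0; rewrite [v]thinmx0 mul0mx.
- by move=> i j; rewrite !ord1 mxE eqxx mulr1n dhomogX.
Qed.

(** Induction on the construction, which also supplies a resolution of the intersection. *)
Lemma constructible_linear_resolution q (I : set S) : constructible q I ->
  exists F (e : 'cV_(frk F 0)), linear_resolution q I e.
Proof.
elim=> [u|{}q I1 I2 _ [F1 [e1 lin1]] _ [F2 [e2 lin2]] _ [G [eG linG]]].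
  exact: linear_resolution_principal.
have [F [e [lin _]]] := linear_resolution_sum lin1 lin2 linG.
by exists F, e.
Qed.

End Resolutions.

Theorem corollary3p2p4 (k : fieldType) (n q : nat)
    (I I1 I2 : set {mpoly k[n]})
    (hI : constructible q I)
    (hI1 : constructible q I1)
    (hI2 : constructible q I2)
    (hI12 : constructible q.+1 (I1 `&` I2))
    (hsum : I = sum_ideal I1 I2) :
  forall i : int,
    betti I i = (betti I1 i + betti I2 i + betti (I1 `&` I2) (i - 1)%R)%N.
Proof.
have [F1 [e1 lin1]] := constructible_linear_resolution hI1.
have [F2 [e2 lin2]] := constructible_linear_resolution hI2.
have [G [eG linG]] := constructible_linear_resolution hI12.
have [F [e [lin FE]]] := linear_resolution_sum lin1 lin2 linG.
rewrite -hsum in lin; case=> [i|i] //=.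
rewrite (tor_dim_linear i lin) (tor_dim_linear i lin1) (tor_dim_linear i lin2).
(* For index 0, [shift_rank G 0] and the Betti number of index -1 are both zero. *)
rewrite FE; case: i => [|i] //=; congr (_ + _)%N.
by rewrite subn1 (tor_dim_linear i linG).
Qed.
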